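(* Let $N\ge 2$, let $\mathcal{K}\subseteq\mathbb{Z}_N$ be an $(N,K,\lambda)$ difference set, let $v=\frac{1}{\sqrt{K}}\chi_{\mathcal{K}}\in\mathbb{C}^N$, and for $i=0,\dots,N-1$ let $\mathcal{W}_i=\operatorname{span}\{M_jT_iv\}_{j=0}^{N-1}\subseteq\mathbb{C}^N$. Then the Gabor fusion frame $\{\mathcal{W}_i\}_{i=0}^{N-1}$ associated to $\mathcal{K}$ is an optimal Grassmannian packing of $N$ $K$-dimensional subspaces in $\mathbb{C}^N$.
   Context: $\mathbb{Z}_N=\{0,1,\dots,N-1\}$ with arithmetic modulo $N$; vectors in $\mathbb{C}^N$ are indexed by $\mathbb{Z}_N$, and all index operations are modulo $N$. Difference set: a nonempty subset $\mathcal{K}=\{u_1,\dots,u_K\}\subseteq\mathbb{Z}_N$ with $K$ elements is an $(N,K,\lambda)$ difference set if the $K(K-1)$ differences $(u_k-u_l)\bmod N$, $k\ne l$, take all nonzero values $1,2,\dots,N-1$, each exactly $\lambda$ times. $\chi_{\mathcal{K}}\in\mathbb{C}^N$ is the characteristic function of $\mathcal{K}$: $\chi_{\mathcal{K}}(j)=1$ if $j\in\mathcal{K}$ and $0$ otherwise. Modulation and translation operators on $\mathbb{C}^N$: $(M_jg)(n)=e^{2\pi i jn/N}g(n)$ and $(T_kg)(n)=g(n-k)$ for $n=0,\dots,N-1$. The subspace $\mathcal{W}_i$ is also described as the space of all $x\in\mathbb{C}^N$ with $\operatorname{supp}(x)\subseteq\mathcal{K}+i$. Chordal distance: for subspaces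 $\mathcal{W}_1,\mathcal{W}_2$ of $\mathbb{C}^N$ of the same dimension $m$, with orthogonal projections $P_1,P_2$, the chordal distance $d_c(\mathcal{W}_1,\mathcal{W}_2)\ge 0$ is given by $d_c^2(\mathcal{W}_1,\mathcal{W}_2)=m-\operatorname{Tr}[P_1P_2]$. Optimal (Grassmannian) packing: for given $m,M,N$, a family $\{\mathcal{W}_i\}_{i=1}^M$ of $m$-dimensional subspaces of $\mathbb{C}^N$ is an optimal packing if $\min_{i\ne j}d_c(\mathcal{W}_i,\mathcal{W}_j)$ is as large as possible among all families of $M$ $m$-dimensional subspaces of $\mathbb{C}^N$. *)

(* Defs.v *)
From mathcomp Require Import all_boot all_order all_algebra.
From mathcomp Require Import sesquilinear spectral.
From mathcomp Require Import reals constructive_ereal trigo.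
From mathcomp Require Import complex.

Set Implicit Arguments.
Unset Strict Implicit.
Unset Printing Implicit Defensive.

Import Order.TTheory GRing.Theory Num.Theory.
Local Open Scope ring_scope.
Local Open Scope complex_scope.

(* Z_N, for N = n.+1, is 'I_n.+1 with its zmodType structure (arithmetic
   modulo n.+1); C^N is 'rV[R[i]]_N; a subspace of C^N is given by a matrix
   with row space that subspace, so its dimension is the rank. *)

(* As K <= 1 gives no differences at all, a singleton is a difference set with
   lambda = 0. *)
Definition is_difference_set (n K lambda : nat) (D : {set 'I_n.+1}) : Prop :=
  [/\ D != set0,
      #|D| = K &
      forall d : 'I_n.+1, d != 0 ->
        #|[set p in setX D D | (p.1 != p.2) && (p.1 - p.2 == d)]| = lambda].

Section Gabor.
Context {R : realType} {n : nat}.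
Local Notation N := n.+1.

Definition cis (t : R) : R[i] := cos t +i* sin t.

Definition modulation (j : 'I_N) (g : 'rV[R[i]]_N) : 'rV[R[i]]_N :=
  \row_(m < N) (cis (2 * pi * (j * m)%N%:R / N%:R) * g 0 m).

Definition translation (k : 'I_N) (g : 'rV[R[i]]_N) : 'rV[R[i]]_N :=
  \row_(m < N) g 0 (m - k).

Definition char_vec (D : {set 'I_N}) : 'rV[R[i]]_N :=
  \row_(m < N) (m \in D)%:R.

Definition gabor_window (D : {set 'I_N}) : 'rV[R[i]]_N :=
  (Num.sqrt (#|D|%:R : R))^-1%:C *: char_vec D.

Definition gabor_fusion_frame (D : {set 'I_N}) (i : 'I_N) : 'M[R[i]]_N :=
  (\sum_(j < N) <<modulation j (translation i (gabor_window D))>>)%MS.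

End Gabor.

Section Packing.
Context {R : realType}.

(* Meant for subspaces of the same dimension. The trace of a product of two
   orthogonal projections is real, so Re loses nothing. [proj_ortho] is the
   orthogonal projection for the Hermitian product, acting on row vectors. *)
Definition chordal_dist (N : nat) (U V : 'M[R[i]]_N) : R :=
  Num.sqrt ((\rank U)%:R - complex.Re (\tr (proj_ortho U *m proj_ortho V))).

(* +oo is only the value of the empty minimum, i.e. when M <= 1. *)
Definition min_chordal_dist (M N : nat) (W : 'I_M -> 'M[R[i]]_N) : \bar R :=
  \big[Order.min/+oo%E]_(p : 'I_M * 'I_M | p.1 != p.2)
     (chordal_dist (W p.1) (W p.2))%:E.

Definition is_optimal_packing (m M N : nat) (W : 'I_M -> 'M[R[i]]_N) : Prop :=
  (forall i, \rank (W i) = m) /\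
  (forall V : 'I_M -> 'M[R[i]]_N, (forall i, \rank (V i) = m) ->
     (min_chordal_dist V <= min_chordal_dist W)%E).

End Packing.

(* Main.v *)
Require Import Defs.
From mathcomp Require Import all_boot all_order all_algebra.
From mathcomp Require Import sesquilinear spectral.
From mathcomp Require Import reals constructive_ereal trigo.
From mathcomp Require Import complex ring lra.

(** Write P_i for the orthogonal projection onto the i-th subspace.  For M
    subspaces of dimension m in C^N the sum S of the P_i has trace M m, and
    S - (M m / N) I is Hermitian, so its square has nonnegative trace; expanding
    that square bounds the sum of the tr (P_i P_j) over the pairs i != j from
    below ([sum_mxtrace_proj_ortho_ge]).  Some pair must therefore reach the
    average of these traces, so the minimal squared chordal distance is at most
    m (N - m) M / (N (M - 1)), the simplex bound of Rankin ([rankin_bound]).  It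
    remains to see that the Gabor fusion frame of a difference set D of size K
    attains this bound at every pair.

    The modulations of a translate of the window are the rows of an invertible
    Fourier matrix times the diagonal matrix of that translate, so W_i is the
    span of the coordinate vectors indexed by D + i ([gabor_fusion_frameE]).
    Hence P_i P_j is the coordinate projection onto (D + i) :&: (D + j), whose
    trace counts the ways of writing j - i as a difference of two elements of D:
    it is lambda for all i != j ([card_translateI]).  All distances are thus
    equal to sqrt (K - lambda), and the count lambda (N - 1) = K (K - 1)
    identifies K - lambda with the simplex bound for m = K and M = N
    ([difference_set_rankin]). *)

Set Implicit Arguments.
Unset Strict Implicit.
Unset Printing Implicit Defensive.

Import Order.TTheory GRing.Theory Num.Theory.
Local Open Scope ring_scope.
Local Open Scope complex_scope.
Local Open Scope sesquilinear_scope.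

(** * Orthogonal projections and their traces *)

Section OrthogonalProjections.
Context {C : numClosedFieldType}.

(** When P is Hermitian and idempotent, the rows of 1 - P are orthogonal to the
    row space of P, so 1 = P + (1 - P) is the decomposition that defines the projection. *)
Lemma proj_ortho_unique p n (U : 'M[C]_(p, n)) (P : 'M[C]_n) :
  P^t* = P -> P *m P = P -> (P :=: U)%MS -> proj_ortho U = P.
Proof.
move=> Pherm Pidem PU; rewrite -[LHS]mul1mx -[X in X *m _](subrK P) mulmxDl.
rewrite [P *m _]proj_ortho_id ?PU // proj_ortho_0 ?add0r //.
apply/orthomx1P; have /submxP[X ->] : (U <= P)%MS by rewrite PU.
by rewrite trmx_mul map_mxM Pherm mulmxA mulmxBl mul1mx Pidem subrr mul0mx.
Qed.

(** An orthonormal basis turns the projection into a Gram-type product, from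
    which both its symmetry and its trace can be read off. *)
Lemma proj_ortho_schmidt p n (U : 'M[C]_(p, n)) :
  let B := schmidt (row_base U) in proj_ortho U = B^t* *m B.
Proof.
move=> B; have /unitarymxP Bu : B \is unitarymx.
  exact/schmidt_unitarymx/rank_leq_col.
have BU : (B :=: U)%MS.
  apply: eqmx_trans (eq_row_base U).
  exact/eqmx_schmidt_free/row_base_free.
apply: proj_ortho_unique.
- by rewrite trmx_mul map_mxM /= trmxCK.
- by rewrite mulmxA -[B^t* *m B *m _]mulmxA Bu mulmx1.
- apply: eqmx_trans BU; apply/eqmxP; rewrite submxMl /=.
  by rewrite -[X in (X <= _)%MS]mul1mx -Bu -mulmxA submxMl.
Qed.

Lemma trmxC_proj_ortho p n (U : 'M[C]_(p, n)) :
  (proj_ortho U)^t* = proj_ortho U.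
Proof. by rewrite proj_ortho_schmidt trmx_mul map_mxM /= trmxCK. Qed.

Lemma mxtrace_proj_ortho p n (U : 'M[C]_(p, n)) :
  \tr (proj_ortho U) = (\rank U)%:R.
Proof.
rewrite proj_ortho_schmidt mxtrace_mulC (unitarymxP _) ?mxtrace1 //.
exact/schmidt_unitarymx/rank_leq_col.
Qed.

Lemma mxtrace_mul_trmxC_ge0 m n (A : 'M[C]_(m, n)) : 0 <= \tr (A *m A^t*).
Proof.
apply: sumr_ge0 => i _; rewrite mxE; apply: sumr_ge0 => j _.
by rewrite !mxE mul_conjC_ge0.
Qed.

(** This is the Cauchy-Schwarz inequality (tr S)^2 <= N tr (S^2) for the sum S of
    the projections, where the diagonal pairs contribute M m to tr (S^2).  It is
    obtained from the square of N S - (M m) I. *)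
Lemma sum_mxtrace_proj_ortho_ge (M N m : nat) (V : 'I_M -> 'M[C]_N) :
  (0 < N)%N -> (forall i, \rank (V i) = m) ->
  ((M * m) ^ 2)%:R <=
    N%:R * ((M * m)%:R + \sum_(p : 'I_M * 'I_M | p.1 != p.2)
                   \tr (proj_ortho (V p.1) *m proj_ortho (V p.2))).
Proof.
move=> N_gt0 rV; set S := \sum_i proj_ortho (V i); set c : C := (M * m)%:R.
have sum_rank : \sum_(i < M) (m%:R : C) = c.
  by rewrite sumr_const card_ord /c mulnC natrM mulr_natr.
have trS : \tr S = c.
  rewrite raddf_sum -sum_rank /=.
  by apply: eq_bigr => i _; rewrite mxtrace_proj_ortho rV.
have trSS : \tr (S *m S) =
    c + \sum_(p : 'I_M * 'I_M | p.1 != p.2)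
          \tr (proj_ortho (V p.1) *m proj_ortho (V p.2)).
  have -> : S *m S = \sum_i \sum_j proj_ortho (V i) *m proj_ortho (V j).
    by rewrite mulmx_suml; apply: eq_bigr => i _; rewrite mulmx_sumr.
  rewrite pair_bigA raddf_sum (bigID (fun p => p.1 == p.2)) /=.
  congr (_ + _).
  rewrite -(pair_big_dep predT eq_op (fun i j =>
    \tr (proj_ortho (V i) *m proj_ortho (V j)))) /= -sum_rank.
  apply: eq_bigr => i _; rewrite (eq_bigl (pred1 i)) => [|j];
    last exact: eq_sym.
  by rewrite big_pred1_eq proj_ortho_proj mxtrace_proj_ortho rV.
have Sherm : S^t* = S.
  by rewrite !raddf_sum /=; apply: eq_bigr => i _; exact: trmxC_proj_ortho.
rewrite -trSS natrX -/c.
have := mxtrace_mul_trmxC_ge0 (N%:R *: S - c%:M).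
have -> : (N%:R *: S - c%:M)^t* = N%:R *: S - c%:M.
  rewrite linearB /= linearZ /= tr_scalar_mx map_mxB map_mxZ map_scalar_mx.
  by rewrite Sherm /= !conjC_nat.
rewrite mulmxBl !mulmxBr -!scalemxAl -!scalemxAr -scalar_mxM.
rewrite mul_mx_scalar mul_scalar_mx.
rewrite !raddfB /= !linearZ /= trS mxtrace_scalar.
set t := \tr _; set q : C := N%:R => H.
have q_gt0 : 0 < q by rewrite ltr0n.
have {H} : 0 <= q * (q * t - c ^+ 2).
  by apply: le_trans H _; rewrite le_eqVlt; apply/orP; left; apply/eqP; ring.
by rewrite pmulr_rge0 // subr_ge0.
Qed.
End OrthogonalProjections.

(** * The simplex bound *)

Section RankinBound.
Context {R : realType}.

Lemma card_neq_pairs M :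
  #|[pred p : 'I_M * 'I_M | p.1 != p.2]| = (M * M.-1)%N.
Proof.
rewrite -sum1_card.
rewrite -(pair_big_dep predT (fun i j => i != j) (fun _ _ => 1%N)) /=.
rewrite (eq_bigr (fun=> M.-1)) ?sum_nat_const ?card_ord // => i _.
rewrite sum1_card; transitivity #|predC1 i|; last by rewrite cardC1 card_ord.
by apply: eq_card => j; rewrite !inE eq_sym.
Qed.

(** Complex numbers are only partially ordered, and [chordal_dist] takes real
    parts: this carries [sum_mxtrace_proj_ortho_ge] over to the reals. *)
Lemma le_Re_nat (a b c : nat) (z : R[i]) :
  a%:R <= c%:R * (b%:R + z) -> a%:R <= c%:R * (b%:R + complex.Re z) :> R.
Proof.
have natE k : (k%:R : R[i]) = k%:R%:C by rewrite raddfMn.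
case: z => x y; rewrite !natE lecE /= => /andP[_].
by rewrite mul0r subr0.
Qed.

(** If every pair were farther apart than the bound, summing the traces over the
    M (M - 1) ordered pairs would contradict [sum_mxtrace_proj_ortho_ge]. *)
Lemma rankin_bound (M N m : nat) (V : 'I_M -> 'M[R[i]]_N) :
  (1 < M)%N -> (0 < N)%N -> (forall i, \rank (V i) = m) ->
  (min_chordal_dist V <=
    (Num.sqrt (m%:R * (N%:R - m%:R) * M%:R / (N%:R * (M%:R - 1)) : R))%:E)%E.
Proof.
move=> M_gt1 N_gt0 rV.
pose t (p : 'I_M * 'I_M) :=
  complex.Re (\tr (proj_ortho (V p.1) *m proj_ortho (V p.2))).
pose b : R := m%:R * (N%:R - m%:R) * M%:R / (N%:R * (M%:R - 1)).
suff /existsP[p /andP[p_neq bp]] :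
    [exists p, (p.1 != p.2) && (m%:R - t p <= b)].
  apply: (@bigmin_inf _ _ _ _ p) => //.
  by rewrite lee_fin /chordal_dist rV; exact: ler_wsqrtr.
apply: contraT; rewrite negb_exists => /forallP tlt.
have {}tlt p : p.1 != p.2 -> t p < m%:R - b.
  by move=> pn; have := tlt p; rewrite pn /= -ltNge; lra.
have M_gt0 : (0 < M)%N by exact: ltnW.
have sum_lt : \sum_(p : 'I_M * 'I_M | p.1 != p.2) t p
    < (M * M.-1)%:R * (m%:R - b).
  rewrite mulr_natl -card_neq_pairs -sumr_const; apply: ltr_sum => //.
  by apply/hasP; exists (Ordinal M_gt0, Ordinal M_gt1) => //;
    exact: mem_index_enum.
have := le_Re_nat (sum_mxtrace_proj_ortho_ge N_gt0 rV).
rewrite raddf_sum /= -/t => sum_ge; move: sum_ge sum_lt.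
set T := \sum_(p | _) _.
have predM : M.-1%:R = M%:R - 1 :> R by rewrite -subn1 natrB.
rewrite -[_ *+ N]mulr_natl natrX !natrM predM /b.
move: M_gt0 M_gt1 N_gt0; rewrite -!(ltr_nat R).
set x : R := M%:R; set y : R := N%:R; set z : R := m%:R => x0 x1 y0.
have x1' : x - 1 != 0 by lra.
have y0' : y != 0 by lra.
have -> : x * (x - 1) * (z - z * (y - z) * x / (y * (x - 1))) =
          ((x * z) ^+ 2 - y * (x * z)) / y by field; rewrite x1' y0'.
by rewrite ltr_pdivlMr // => *; lra.
Qed.
End RankinBound.

(** * Coordinate subspaces *)

Section CoordinateSubspaces.
Context {C : numClosedFieldType} {n : nat}.
Implicit Types A B : {set 'I_n}.

Definition coord_proj (A : {set 'I_n}) : 'M[C]_n :=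
  diag_mx (\row_k (k \in A)%:R).

Lemma coord_projM A B : coord_proj A *m coord_proj B = coord_proj (A :&: B).
Proof.
rewrite mulmx_diag; congr diag_mx; apply/rowP => k; rewrite !mxE inE.
by rewrite -natrM mulnb.
Qed.

Lemma mxtrace_coord_proj A : \tr (coord_proj A) = #|A|%:R.
Proof.
rewrite mxtrace_diag -sum1_card natr_sum [RHS]big_mkcond /=.
by apply: eq_bigr => k _; rewrite !mxE; case: (k \in A).
Qed.

Lemma proj_ortho_coord A p (U : 'M[C]_(p, n)) :
  (U :=: coord_proj A)%MS -> proj_ortho U = coord_proj A.
Proof.
move=> UA; apply: proj_ortho_unique; last exact: eqmx_sym.
  rewrite tr_diag_mx map_diag_mx; congr diag_mx.
  by apply/rowP => k; rewrite !mxE rmorph_nat.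
by rewrite coord_projM setIid.
Qed.

Lemma mxrank_coord_proj A : \rank (coord_proj A) = #|A|.
Proof.
apply/eqP; rewrite -(eqr_nat C) -mxtrace_proj_ortho.
by rewrite (@proj_ortho_coord A) // mxtrace_coord_proj.
Qed.

End CoordinateSubspaces.

(** * The subspaces of a Gabor fusion frame *)

Section GaborFrame.
Context {R : realType} {n : nat}.
Local Notation N := n.+1.
Implicit Type D : {set 'I_N}.

Lemma cisX (t : R) k : cis t ^+ k = cis (t * k%:R).
Proof.
elim: k => [|k IHk]; first by rewrite expr0 mulr0 /cis cos0 sin0.
rewrite exprS IHk -natr1 mulrDr mulr1 addrC /cis cosD sinD.
by apply/eqP; rewrite eq_complex /=; apply/andP; split; apply/eqP; ring.
Qed.

(** Equal values at s and t force cos (t - s) = 1, that is sin ((t - s) / 2) = 0,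
    whereas (t - s) / 2 lies strictly between 0 and pi. *)
Lemma cis_inj (s t : R) : 0 <= s -> s < t -> t < 2 * pi -> cis s != cis t.
Proof.
move=> s0 st tpi; apply/negP => /eqP[ec es].
have : cos (t - s) = 1 by rewrite cosB ec es -!expr2 cos2Dsin2.
have -> : t - s = ((t - s) / 2) *+ 2 by rewrite -mulr_natr; field.
rewrite cos_mulr2n => c1; have := cos2Dsin2 ((t - s) / 2).
have : 0 < sin ((t - s) / 2) by apply: sin_gt0_pi; lra.
by move=> /(exprn_gt0 2); lra.
Qed.

(** The Fourier matrix with entries e^(2 pi i j m / N), written as a Vandermonde
    matrix because the nodes e^(2 pi i m / N) are pairwise distinct, which gives
    its invertibility. *)
Definition cis_mx : 'M[R[i]]_N :=
  Vandermonde N (\row_m cis (2 * pi * m%:R / N%:R)).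

Lemma cis_mx_unit : cis_mx \in unitmx.
Proof.
rewrite unitmxE det_Vandermonde unitfE.
apply/prodf_neq0 => i _; apply/prodf_neq0 => j ij.
rewrite !mxE subr_eq0 eq_sym; have pi0 := @pi_gt0 R.
have N0 : 0 < N%:R :> R by rewrite ltr0n.
have tpi0 : 0 < 2 * pi :> R by lra.
apply: cis_inj.
- by rewrite divr_ge0 // mulr_ge0 // ltW.
- by rewrite ltr_pM2r ?invr_gt0 // ltr_pM2l // ltr_nat.
- by rewrite ltr_pdivrMr // ltr_pM2l // ltr_nat.
Qed.

(** The j-th generator of W_i is row j of the Fourier matrix times the diagonal
    matrix of the translated window; multiplying on the left by an invertible
    matrix, or by the nonzero normalization c, keeps the row space. *)
Lemma gabor_fusion_frameE D i : D != set0 ->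
  (@gabor_fusion_frame R n D i :=: coord_proj [set m | (m - i)%R \in D])%MS.
Proof.
move=> D0; set c : R[i] := (Num.sqrt (#|D|%:R : R))^-1%:C.
have c0 : c != 0.
  rewrite eq_complex /= eqxx andbT invr_eq0 sqrtr_eq0 -ltNge ltr0n.
  by rewrite card_gt0.
set P := coord_proj _.
have rowE j : modulation j (translation i (gabor_window D)) =
    row j (c *: (cis_mx *m P)).
  apply/rowP => m; rewrite !mxE (bigD1 m) //= big1 => [|k /negPf km].
    rewrite !mxE eqxx mulr1n addr0 inE cisX.
    rewrite [RHS]mulrCA; congr (cis _ * _).
    by rewrite natrM; field; rewrite nat1r pnatr_eq0.
  by rewrite !mxE km mulr0n mulr0.
apply: eqmx_trans (_ : (c *: (cis_mx *m P) :=: P)%MS); last first.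
  apply: eqmx_trans (eqmx_scale _ c0) _.
  by apply: eqmxMfull; rewrite row_full_unit cis_mx_unit.
apply/eqmxP/andP; split.
  by apply/sumsmx_subP => j _; rewrite genmxE rowE row_sub.
by apply/row_subP => j; apply: (sumsmx_sup j) => //; rewrite genmxE rowE.
Qed.

End GaborFrame.

(** * Counting in difference sets *)

Section DifferenceSets.
Context {n K lambda : nat} {D : {set 'I_n.+1}}.
Context (hD : is_difference_set K lambda D).

(** A common point m of D + i and D + j corresponds to the pair (m - i, m - j) of
    elements of D, whose difference is j - i. *)
Lemma card_translateI (i j : 'I_n.+1) : i != j ->
  #|[set m | (m - i)%R \in D] :&: [set m | (m - j)%R \in D]| = lambda.
Proof.
move=> ij; have [_ _ /(_ (j - i)) <-] := hD; last by rewrite subr_eq0 eq_sym.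
have inj_f : injective (fun m => (m - i, m - j)).
  by move=> x y /(congr1 fst) /addIr.
rewrite -(card_imset _ inj_f); apply: eq_card => -[a b].
apply/imsetP/idP => [[m]|].
  rewrite !inE => /andP[mi mj] [-> ->] /=; rewrite mi mj /=.
  rewrite (inj_eq (addrI m)) (inj_eq oppr_inj) ij /=.
  by rewrite opprB addrC addrA subrK.
rewrite !inE /= => /and3P[/andP[aD bD] _ /eqP abE].
have abi : a + i = b + j by rewrite -(subrK b a) abE addrAC subrK addrC.
by exists (a + i); [rewrite !inE addrK aD abi addrK | rewrite addrK abi addrK].
Qed.

(** Both sides count the ordered pairs of distinct elements of D, on the left
    sorted by their difference. *)
Lemma difference_set_count : (lambda * n = K * K.-1)%N.
Proof.
have [_ <- hdiff] := hD.
transitivity #|[set p in setX D D | p.1 != p.2]|.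
  rewrite -[RHS]sum1_card (partition_big (fun p => p.1 - p.2) (predC1 0)) /=.
    rewrite (eq_bigr (fun=> lambda)) => [|d d0].
      by rewrite sum_nat_const cardC1 card_ord mulnC.
    rewrite sum1_card -(hdiff d d0); apply: eq_card => p.
    by rewrite !inE /= unfold_in /= !inE andbA.
  by move=> p; rewrite inE subr_eq0 => /andP[].
rewrite -sum1_card.
rewrite (eq_bigl (fun p => (p.1 \in D) && ((p.2 \in D) && (p.1 != p.2)))).
  rewrite -(pair_big_dep (mem D) (fun i j => (j \in D) && (i != j))
    (fun _ _ => 1%N)) /=.
  rewrite (eq_bigr (fun=> #|D|.-1)) ?sum_nat_const // => i iD.
  rewrite sum1_card (cardsD1 i D) iD /=; apply: eq_card => j.
  by rewrite !inE andbC eq_sym.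
by move=> p; rewrite !inE andbA.
Qed.

End DifferenceSets.

(** The squared distance K - lambda is the value of [rankin_bound] at m = K and
    M = N. *)
Lemma difference_set_rankin (F : realFieldType) (n K lambda : nat)
    (D : {set 'I_n.+2}) : is_difference_set K lambda D ->
  K%:R * (n.+2%:R - K%:R) * n.+2%:R / (n.+2%:R * (n.+2%:R - 1))
    = K%:R - lambda%:R :> F.
Proof.
move=> hD; have K_gt0 : (0 < K)%N by have [? <- _] := hD; rewrite card_gt0.
have := congr1 (fun k => k%:R : F) (difference_set_count hD).
rewrite !natrM -subn1 natrB // -(natr1 n.+1) -(natr1 n).
have := ler0n F n; set x : F := n%:R; set k : F := K%:R.
clearbody x k; clear => x_ge0 count.
have x1_neq0 : x + 1 != 0 by lra.
have -> : lambda%:R = k * (k - 1) / (x + 1) by rewrite -count mulfK.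
by field; rewrite x1_neq0; lra.
Qed.

(* N = n.+2 ranges over all integers >= 2 *)
Theorem corollary3p6 (R : realType) (n K lambda : nat) (D : {set 'I_n.+2})
    (hD : is_difference_set K lambda D) :
  is_optimal_packing K (@gabor_fusion_frame R n.+1 D).
Proof.
have [D0 cardD _] := hD; pose A i := [set m | (m - i)%R \in D].
have frameE i : (@gabor_fusion_frame R n.+1 D i :=: coord_proj (A i))%MS.
  exact: gabor_fusion_frameE.
have cardA i : #|A i| = K.
  rewrite -cardD -(card_imset D (addIr i)); apply: eq_card => m.
  rewrite inE; apply/idP/imsetP => [mD|[k kD ->]]; last by rewrite addrK.
  by exists (m - i); rewrite ?subrK.
have rankE i : \rank (@gabor_fusion_frame R n.+1 D i) = K.
  by rewrite frameE mxrank_coord_proj cardA.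
split=> [|V rV]; first exact: rankE.
apply: le_trans (@rankin_bound _ n.+2 n.+2 _ _ isT isT rV) _.
apply: le_bigmin => [|[i j] /= ij]; first exact: leey.
rewrite lee_fin /chordal_dist rankE !(proj_ortho_coord (frameE _)).
rewrite coord_projM mxtrace_coord_proj (card_translateI hD) //.
rewrite [complex.Re _]raddfMn /=.
apply: ler_wsqrtr; rewrite le_eqVlt; apply/orP; left; apply/eqP.
exact: difference_set_rankin hD.
Qed.
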